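(* For every real Banach space $X$ with $\dim X\ge 2$ and every $\lambda\in[0,1]$, $$J_\lambda^\perp(X)\le\min\left\{1,\ \sqrt{C_{\mathrm{NJ}}(X)\left(\lambda^2+(1-\lambda)^2\right)}\right\}.$$
   Context: For a real Banach space $X$, $S_X=\{x\in X:\|x\|=1\}$. For $x,y\in X$, $x\perp_B y$ (Birkhoff--James orthogonality) means $\|x\|\le\|x+ty\|$ for every $t\in\mathbb R$. For $\lambda\in[0,1]$, $$J_\lambda^\perp(X)=\sup\{\min\{\|\lambda x+(1-\lambda)y\|,\|\lambda x-(1-\lambda)y\|\}: x,y\in S_X,\ x\perp_B y\}.$$ The von Neumann--Jordan constant is $$C_{\mathrm{NJ}}(X)=\sup\left\{\frac{\|u+v\|^2+\|u-v\|^2}{2(\|u\|^2+\|v\|^2)}: u,v\in X,\ (u,v)\neq(0,0)\right\}.$$ *)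

(* Defs.v *)
From HB Require Import structures.
From mathcomp Require Import all_boot all_order all_algebra.
From mathcomp Require Import all_classical all_reals all_analysis.

Set Implicit Arguments.
Unset Strict Implicit.
Unset Printing Implicit Defensive.

Import Order.TTheory GRing.Theory Num.Theory.
Import numFieldNormedType.Exports.

Local Open Scope classical_set_scope.
Local Open Scope ring_scope.

(* X need not be finite-dimensional, so "dim X >= n" is the existence of a
   linearly independent family of n vectors. *)
Definition dim_ge (n : nat) (R : realType) (X : lmodType R) : Prop :=
  exists e : 'I_n -> X, forall a : 'I_n -> R,
    \sum_(i < n) a i *: e i = 0 -> forall i, a i = 0.

Section Constants.
Context {R : realType} (X : normedModType R).

Definition unit_sphere : set X := [set x | `|x| = 1].

Definition birkhoff_james (x y : X) : Prop :=
  forall t : R, `|x| <= `|x + t *: y|.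

(* The two suprema below are taken in R, where sup is 0 on a set that is empty
   or unbounded above.  By the triangle inequality the first set is bounded by
   1 (for lambda in [0, 1]) and the second by 2; both are nonempty as soon as
   dim X >= 2. *)
Definition J_perp (lambda : R) : R :=
  sup [set r | exists x y : X,
    [/\ unit_sphere x, unit_sphere y, birkhoff_james x y &
        r = Num.min `|lambda *: x + (1 - lambda) *: y|
                    `|lambda *: x - (1 - lambda) *: y|]].

Definition C_NJ : R :=
  sup [set r | exists u v : X, (u, v) != (0, 0) /\
    r = (`|u + v| ^+ 2 + `|u - v| ^+ 2) / (2 * (`|u| ^+ 2 + `|v| ^+ 2))].

End Constants.

(* Main.v *)
Require Import Defs.
From HB Require Import structures.
From mathcomp Require Import all_boot all_order all_algebra.
From mathcomp Require Import all_classical all_reals all_analysis.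
From mathcomp Require Import lra.

Import Order.TTheory GRing.Theory Num.Theory.
Import numFieldNormedType.Exports.

Local Open Scope classical_set_scope.
Local Open Scope ring_scope.

(** Put [u = lambda *: x] and [v = (1 - lambda) *: y] with [x], [y] of norm one.
    The minimum [m] of [`|u + v|] and [`|u - v|] is at most
    [lambda + (1 - lambda) = 1] by the triangle inequality.  Its square is at
    most the mean of the two squares, and the von Neumann-Jordan constant is
    the best factor by which the parallelogram law can fail
    ([C_NJ_parallelogram]), so
    [m ^+ 2 <= C_NJ X * (`|u| ^+ 2 + `|v| ^+ 2)
             = C_NJ X * (lambda ^+ 2 + (1 - lambda) ^+ 2)].
    Taking the supremum over the admissible pairs [x], [y] gives both bounds. *)

(** Each of [`|u + v|], [`|u - v|] is at most [`|u| + `|v|], whose square is at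
    most [2 * (`|u| ^+ 2 + `|v| ^+ 2)].  This bounds by 2 the ratios of which
    [C_NJ] is the supremum. *)
Lemma weak_parallelogram (R : realType) (X : normedModType R) (u v : X) :
  `|u + v| ^+ 2 + `|u - v| ^+ 2 <= 4 * (`|u| ^+ 2 + `|v| ^+ 2).
Proof.
have hp := ler_normD u v; have hm := ler_normB u v.
have p0 := normr_ge0 (u + v); have m0 := normr_ge0 (u - v).
have sq (a : R) : 0 <= a -> a <= `|u| + `|v| ->
    a ^+ 2 <= 2 * (`|u| ^+ 2 + `|v| ^+ 2).
  move=> a0 ha; apply: (@le_trans _ _ ((`|u| + `|v|) ^+ 2)).
    by rewrite lerXn2r ?nnegrE // addr_ge0.
  by have := sqr_ge0 (`|u| - `|v|); lra.
by have := sq _ p0 hp; have := sq _ m0 hm; lra.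
Qed.

(** A supremum taken in the reals is an upper bound only of a set that is
    bounded above; boundedness lets every single ratio be compared with
    [C_NJ]. *)
Lemma C_NJ_has_ubound (R : realType) (X : normedModType R) :
  has_ubound [set r : R | exists u v : X, (u, v) != (0, 0) /\
    r = (`|u + v| ^+ 2 + `|u - v| ^+ 2) / (2 * (`|u| ^+ 2 + `|v| ^+ 2))].
Proof.
exists 2 => _ [u [v [_ ->]]].
have [S0|S0] := eqVneq (`|u| ^+ 2 + `|v| ^+ 2) 0.
  by rewrite S0 mulr0 invr0 mulr0.
have Spos : 0 < `|u| ^+ 2 + `|v| ^+ 2 by rewrite lt0r S0 addr_ge0 ?sqr_ge0.
rewrite ler_pdivrMr ?mulr_gt0 //.
by have := weak_parallelogram _ X u v; lra.
Qed.

Lemma C_NJ_parallelogram (R : realType) (X : normedModType R) (u v : X) :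
  `|u + v| ^+ 2 + `|u - v| ^+ 2 <= 2 * C_NJ X * (`|u| ^+ 2 + `|v| ^+ 2).
Proof.
have [[-> ->]|uv0] := eqVneq (u, v) (0, 0).
  by rewrite subr0 addr0 normr0 expr0n /= addr0 mulr0.
have Spos : 0 < `|u| ^+ 2 + `|v| ^+ 2.
  rewrite lt0r addr_ge0 ?sqr_ge0 // andbT paddr_eq0 ?sqr_ge0 //.
  by rewrite !sqrf_eq0 !normr_eq0 -xpair_eqE.
suff : (`|u + v| ^+ 2 + `|u - v| ^+ 2) / (2 * (`|u| ^+ 2 + `|v| ^+ 2))
    <= C_NJ X.
  by rewrite ler_pdivrMr ?mulr_gt0 // mulrCA mulrA.
by apply: ub_le_sup; [exact: C_NJ_has_ubound | exists u, v].
Qed.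

Lemma min_norm_le_C_NJ (R : realType) (X : normedModType R) (u v : X) :
  Num.min `|u + v| `|u - v|
    <= Num.sqrt (C_NJ X * (`|u| ^+ 2 + `|v| ^+ 2)).
Proof.
set m := Num.min _ _.
have m0 : 0 <= m by rewrite le_min !normr_ge0.
have mp : m ^+ 2 <= `|u + v| ^+ 2.
  by rewrite lerXn2r ?nnegrE // ge_min lexx.
have mm : m ^+ 2 <= `|u - v| ^+ 2.
  by rewrite lerXn2r ?nnegrE // ge_min lexx orbT.
rewrite -(ger0_norm m0) -sqrtr_sqr ler_wsqrtr //.
by have := C_NJ_parallelogram _ X u v; lra.
Qed.

Theorem proposition3p18 (R : realType) (X : completeNormedModType R)
    (hdim : dim_ge 2 X) (lambda : R) (hlambda : 0 <= lambda <= 1) :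
  J_perp X lambda
    <= Num.min 1 (Num.sqrt (C_NJ X * (lambda ^+ 2 + (1 - lambda) ^+ 2))).
Proof.
have /andP[l0 l1] := hlambda.
rewrite /J_perp; set A := [set r | _].
(* The supremum of the empty set is 0, so the empty case is nonnegativity of
   the right-hand side. *)
have [->|/set0P A0] := eqVneq A set0.
  by rewrite sup0 le_min ler01 sqrtr_ge0.
apply: ge_sup => // _ [x [y [x1 y1 _ ->]]].
have nu : `|lambda *: x| = lambda by rewrite normrZ x1 mulr1 ger0_norm.
have nv : `|(1 - lambda) *: y| = 1 - lambda.
  by rewrite normrZ y1 mulr1 ger0_norm // subr_ge0.
rewrite le_min; apply/andP; split.
  rewrite ge_min; apply/orP; left.
  by apply: le_trans (ler_normD _ _) _; rewrite nu nv addrC subrK.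
have := @min_norm_le_C_NJ _ X (lambda *: x) ((1 - lambda) *: y).
by rewrite nu nv.
Qed.
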